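(* Let $\mathbb{F}$ be a field of characteristic zero or larger than $d$. Let $\mu \geq w$ be positive integers and let $W \subseteq \mathbb{F}[x_1,\dots,x_k]$ be an $\mathbb{F}$-linear subspace of $k$-variate polynomials of degree at most $d$ with $\dim W \leq w$. For $\mathbf{a} \in \mathbb{F}^k$, let $H_{\mathbf{a}}$ be the $\mathbb{F}$-linear space of polynomials of degree at most $d$ which vanish with multiplicity at least $\mu$ at $\mathbf{a}$. Then for every finite set $S \subseteq \mathbb{F}$, \[\sum_{\mathbf{a} \in S^k} \dim(H_{\mathbf{a}} \cap W) \leq \frac{d w |S|^{k-1}}{\mu - w + 1}.\]
   Context: The Hasse derivative $\frac{\partial f}{\partial \mathbf{x}^{\mathbf{e}}}$ of $f \in \mathbb{F}[\mathbf{x}]$ is the coefficient of $\mathbf{z}^{\mathbf{e}}$ in $f(\mathbf{x}+\mathbf{z})$. A polynomial $f$ vanishes with multiplicity at least $\mu$ at $\mathbf{a}$ if $\frac{\partial f}{\partial\mathbf{x}^{\mathbf{e}}}(\mathbf{a}) = 0$ for all $\mathbf{e}\in\mathbb{Z}_{\geq0}^k$ with $\|\mathbf{e}\|_1 < \mu$. *)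

(* Defs.v *)
From HB Require Import structures.
From Stdlib Require Import ClassicalDescription ClassicalEpsilon.
From mathcomp Require Import all_boot all_order all_algebra.
From mathcomp Require Import mpoly.

Set Implicit Arguments.
Unset Strict Implicit.
Unset Printing Implicit Defensive.

Import GRing.Theory.
Local Open Scope ring_scope.

Section Defs.
Context (F : fieldType) (k : nat).

(* f(x + z), viewed as a polynomial in z with coefficients in F[x]. *)
Definition shift_mpoly (f : {mpoly F[k]}) : {mpoly {mpoly F[k]}[k]} :=
  mmap (fun c : F => (c%:MP : {mpoly F[k]})%:MP)
       (fun i : 'I_k => ('X_i : {mpoly F[k]})%:MP + 'X_i) f.

Definition hasse (e : 'X_{1..k}) (f : {mpoly F[k]}) : {mpoly F[k]} :=
  (shift_mpoly f)@_e.

Definition vanish_mult (mu : nat) (a : 'I_k -> F) (f : {mpoly F[k]}) : Prop :=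
  forall e : 'X_{1..k}, (mdeg e < mu)%N -> (hasse e f).@[a] = 0.

Definition deg_le (d : nat) (f : {mpoly F[k]}) : Prop := (msize f <= d.+1)%N.

Definition H_space (d mu : nat) (a : 'I_k -> F) (f : {mpoly F[k]}) : Prop :=
  deg_le d f /\ vanish_mult mu a f.

Definition is_subspace (W : {mpoly F[k]} -> Prop) : Prop :=
  W 0 /\ forall (c : F) (p q : {mpoly F[k]}), W p -> W q -> W (c *: p + q).

Definition lin_indep (n : nat) (s : n.-tuple {mpoly F[k]}) : Prop :=
  forall c : 'I_n -> F, \sum_(i < n) c i *: tnth s i = 0 -> forall i, c i = 0.

Definition has_free (P : {mpoly F[k]} -> Prop) (n : nat) : Prop :=
  exists s : n.-tuple {mpoly F[k]}, (forall i, P (tnth s i)) /\ lin_indep s.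

Definition has_freeb (P : {mpoly F[k]} -> Prop) (n : nat) : bool :=
  if excluded_middle_informative (has_free P n) then true else false.

Lemma has_freeb0 P : has_freeb P 0.
Proof.
rewrite /has_freeb; case: excluded_middle_informative => // [[]].
by exists [tuple]; split=> [[]|c _ []].
Qed.

(* Dimension of a subspace: the largest size of a linearly independent
   family in it (0 if there is no such largest size, i.e. infinite dim). *)
Definition dimP (P : {mpoly F[k]} -> Prop) : nat :=
  match excluded_middle_informative
          (exists m, forall n, has_freeb P n -> (n <= m)%N) with
  | left Hb =>
      ex_maxn (ex_intro _ 0%N (has_freeb0 P))
              (proj2_sig (constructive_indefinite_description _ Hb))
  | right _ => 0%N
  end.

End Defs.

(* Main.v *)
(** Let b_1, ..., b_s be a basis of W. Some generalized Wronskian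
    det (\partial^(e_i) b_j) with all |e_i| < s is a nonzero polynomial, of degree
    at most s d. If dim (H_a \cap W) = t, change the basis of W so that its
    first t elements lie in H_a: then t columns of the Wronskian vanish at a with
    multiplicity at least mu - s + 1, so the determinant vanishes at a with
    multiplicity at least t (mu - s + 1). The bound is then the Schwartz-Zippel
    lemma with multiplicities.

    For the Wronskian, let V_n be the span over F(x) of the vectors
    (\partial^e b_j)_j with |e| < n. Differentiating the relations orthogonal to
    V_n shows that V_n = V_{n+1} forces the chain to be stationary, and as the
    characteristic exceeds d, a vector orthogonal to all the V_n gives a linear
    relation between the b_j over F. Hence dim V_n >= min (n, s). *)
Require Import Defs.
From HB Require Import structures.
From Stdlib Require Import ClassicalEpsilon.
From mathcomp Require Import all_boot all_order all_algebra.
From mathcomp Require Import perm finmap mpoly.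

Set Implicit Arguments.
Unset Strict Implicit.
Unset Printing Implicit Defensive.

Import Order.TTheory GRing.Theory Num.Theory.
Local Open Scope ring_scope.

(** * Translations and multiplicities *)

Lemma mnm_ind (n : nat) (P : 'X_{1..n} -> Prop) :
  P 0%MM -> (forall m i, P m -> P (m + U_(i))%MM) -> forall m, P m.
Proof.
move=> P0 PS m; move: {-1}(mdeg m) (erefl (mdeg m)) => d.
elim: d m => [|d IHd] m dm.
  by move/eqP: dm; rewrite mdeg_eq0 => /eqP ->.
have [i mi] : exists i, (0 < m i)%N.
  apply/existsP; apply: contraT; rewrite negb_exists => /forallP m0.
  move: dm; rewrite mdegE big1 // => i _; apply/eqP.
  by have := m0 i; rewrite lt0n negbK.
have lm : (U_(i) <= m)%MM.
  by apply/mnm_lepP => j; rewrite mnm1E; case: eqP => // <-.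
rewrite -(submK lm); apply/PS/IHd/succn_inj.
by rewrite -dm -{2}(submK lm) mdegD mdeg1 addn1.
Qed.

Lemma eq_mpoly_rmorph (n : nat) (R S : comNzRingType)
    (phi psi : {rmorphism {mpoly R[n]} -> S}) :
    (forall c, phi c%:MP = psi c%:MP) -> (forall i, phi 'X_i = psi 'X_i) ->
  phi =1 psi.
Proof.
move=> eqC eqX p; rewrite (mpolyE p) !rmorph_sum; apply: eq_bigr => m _.
rewrite -mul_mpolyC !rmorphM /= eqC mpolyXE_id !rmorph_prod.
by congr (_ * _); apply: eq_bigr => i _; rewrite !rmorphXn /= eqX.
Qed.

Section Translate.
Context (n : nat) (R : comNzRingType).
Implicit Types (p q : {mpoly R[n]}) (a : 'I_n -> R) (m : 'X_{1..n}).

(** The coefficients of the translate are the values at [a] of the Hasse derivatives of [p], so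
    multiplicities can be read off from coefficients. *)
Definition translate a p : {mpoly R[n]} :=
  p \mPo [tuple 'X_i + (a i)%:MP | i < n].

HB.instance Definition _ a := GRing.RMorphism.copy (translate a)
  (comp_mpoly [tuple 'X_i + (a i)%:MP | i < n]).

Lemma translateC a c : translate a c%:MP = c%:MP.
Proof. exact: comp_mpolyC. Qed.

Lemma translateX a i : translate a 'X_i = 'X_i + (a i)%:MP.
Proof. by rewrite /translate comp_mpolyXU -tnth_nth tnth_mktuple. Qed.

Lemma translateZ a c p : translate a (c *: p) = c *: translate a p.
Proof. exact: comp_mpolyZ. Qed.

Lemma translateK a : cancel (translate a) (translate (fun i => - a i)).
Proof.
move=> p; apply: (@eq_mpoly_rmorph _ _ _
  (translate (fun i => - a i) \o translate a) idfun) => [c|i] /=.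
  by rewrite !translateC.
by rewrite translateX rmorphD /= translateX translateC rmorphN addrNK.
Qed.

Lemma translate_eq0 a p : (translate a p == 0) = (p == 0).
Proof.
apply/eqP/eqP => [p0|->]; last exact: rmorph0.
by rewrite -(translateK a p) p0 rmorph0.
Qed.

Lemma mderiv_translate a i p :
  (translate a p)^`M(i) = translate a p^`M(i).
Proof.
pose Q p := (translate a p)^`M(i) = translate a p^`M(i).
have QM q1 q2 : Q q1 -> Q q2 -> Q (q1 * q2).
  by rewrite /Q => h1 h2; rewrite rmorphM !mderivM h1 h2 rmorphD !rmorphM.
have QC c : Q c%:MP by rewrite /Q translateC !mderivC rmorph0.
have QX j : Q 'X_j.
  rewrite /Q translateX mderivD mderivC addr0 mderivX.
  rewrite mnm1E; case: eqP => [->|_]; last by rewrite !scale0r rmorph0.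
  have -> : (U_(i) - U_(i) = 0 :> 'X_{1..n})%MM.
    by rewrite -{1}[U_(i)%MM]add0m addmK.
  by rewrite !scale1r mpolyX0 rmorph1.
elim/mpolyind: p => [|c m p _ _ Qp]; first by rewrite rmorph0 !mderiv0 rmorph0.
rewrite rmorphD !mderivD Qp rmorphD; congr (_ + _).
rewrite -/(Q _) -mul_mpolyC mpolyXE_id; apply: (QM) => //.
elim/big_ind: _ => [|//|j _]; first by rewrite -mpolyC1.
by elim: (m j) => [|e IHe]; rewrite ?expr0 -?mpolyC1 // exprS; apply: QM.
Qed.

Lemma mderivm_translate a m p :
  (translate a p)^`M[m] = translate a p^`M[m].
Proof.
elim/mnm_ind: m => [|m i IHm]; first by rewrite !mderivm0m.
by rewrite !mderivmDm !mderivmU1m IHm mderiv_translate.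
Qed.

Definition mult_ge (mu : nat) a p :=
  forall m, (mdeg m < mu)%N -> (translate a p)@_m = 0.

Lemma mult_ge_leq mu nu a p : (mu <= nu)%N -> mult_ge nu a p -> mult_ge mu a p.
Proof. by move=> le vp m lt; apply: vp; apply: leq_trans le. Qed.

Lemma mult_geD mu a p q : mult_ge mu a p -> mult_ge mu a q ->
  mult_ge mu a (p + q).
Proof. by move=> vp vq m lt; rewrite rmorphD mcoeffD vp // vq // addr0. Qed.

(** A monomial of degree below [mu + nu] splits only into pairs in which one factor is too low for
    [p] or for [q]. *)
Lemma mult_geM mu nu a p q : mult_ge mu a p -> mult_ge nu a q ->
  mult_ge (mu + nu) a (p * q).
Proof.
move=> vp vq m lt; rewrite rmorphM mcoeffM big1 // => -[m1 m2] /= /eqP eqm.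
have [lt1|ge1] := ltnP (mdeg m1) mu; first by rewrite vp // mul0r.
rewrite vq ?mulr0 // -(ltn_add2l (mdeg m1)) -mdegD -eqm.
by apply: leq_trans lt _; rewrite leq_add2r.
Qed.

Lemma mult_geZ mu a c p : mult_ge mu a p -> mult_ge mu a (c *: p).
Proof. by move=> vp m lt; rewrite translateZ mcoeffZ vp ?mulr0. Qed.

Lemma mult_ge_sum (I : Type) (r : seq I) (P : pred I) mu a
    (F : I -> {mpoly R[n]}) :
  (forall i, P i -> mult_ge mu a (F i)) -> mult_ge mu a (\sum_(i <- r | P i) F i).
Proof.
move=> vF; elim/big_ind: _ => // [m _|p q]; last exact: mult_geD.
by rewrite rmorph0 mcoeff0.
Qed.

Lemma mult_ge_prod (I : Type) (r : seq I) (P : pred I) (mu : I -> nat) a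
    (F : I -> {mpoly R[n]}) :
  (forall i, P i -> mult_ge (mu i) a (F i)) ->
  mult_ge (\sum_(i <- r | P i) mu i) a (\prod_(i <- r | P i) F i).
Proof. by move=> vF; elim/big_rec2: _ => // i q nu Pi; apply/mult_geM/vF. Qed.

(** The coefficient of an ordinary derivative at [m'] is an integer multiple of the one of [p] at
    [m + m'], so plain derivatives lower the multiplicity no more than Hasse derivatives do. *)
Lemma mult_ge_mderivm mu a m p :
  mult_ge mu a p -> mult_ge (mu - mdeg m) a p^`M[m].
Proof.
move=> vp m' lt; rewrite -mderivm_translate mcoeff_mderivm vp ?mul0rn //.
by rewrite mdegD -ltn_subRL.
Qed.

Lemma msize_leP d p : reflect (forall m, (d <= mdeg m)%N -> p@_m = 0)
  (msize p <= d)%N.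
Proof.
apply: (iffP idP) => [le m dm|h].
  by apply/memN_msupp_eq0/msize_mdeg_ge/(leq_trans le).
rewrite msizeE; apply/bigmax_leqP_seq => m; rewrite mcoeff_msupp => pm _.
by rewrite ltnNge; apply: contra pm => /h ->.
Qed.

Lemma msize_mderivm d m p : (msize p <= d)%N -> (msize p^`M[m] <= d)%N.
Proof.
move=> /msize_leP sp; apply/msize_leP => m' dm'.
by rewrite mcoeff_mderivm sp ?mul0rn // mdegD (leq_trans dm') ?leq_addl.
Qed.

Lemma msize_mul_le d e p q :
  (msize p <= d.+1)%N -> (msize q <= e.+1)%N -> (msize (p * q) <= (d + e).+1)%N.
Proof.
move=> /msize_leP sp /msize_leP sq; apply/msize_leP => m lt.
rewrite mcoeffM big1 // => -[m1 m2] /= /eqP eqm.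
have [lt1|ge1] := ltnP d (mdeg m1); first by rewrite sp // mul0r.
rewrite sq ?mulr0 // -(ltn_add2l (mdeg m1)) -mdegD -eqm.
by apply: leq_trans lt; rewrite ltnS leq_add2r.
Qed.

Lemma msize_det_le (s d : nat) (M : 'M[{mpoly R[n]}]_s) :
  (forall i j, msize (M i j) <= d.+1)%N -> (msize (\det M) <= (s * d).+1)%N.
Proof.
move=> sM; apply: leq_trans (mmeasure_sum _ _ _ _) _.
apply/bigmax_leqP => sg _; rewrite -signr_odd mulr_sign.
rewrite (fun_if (fun q => msize q)) mmeasureN if_same.
rewrite -[s in (s * d)%N]card_ord -sum_nat_const.
elim/big_ind2: _ => [|d1 p1 d2 p2|i _]; [by rewrite msize1| | exact: sM].
by apply: msize_mul_le.
Qed.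
End Translate.

(** Setting [x = a] in [f(x + z)] gives the translate, as both ring morphisms agree on constants and
    variables. *)
Lemma mult_ge_vanish (F : fieldType) (k mu : nat) (a : 'I_k -> F)
    (f : {mpoly F[k]}) :
  vanish_mult mu a f -> mult_ge mu a f.
Proof.
move=> vf m lt; rewrite -(vf m lt) /hasse -mcoeff_map_mpoly.
congr (_@_m); rewrite /shift_mpoly.
apply: (@eq_mpoly_rmorph _ _ _ (translate a)
  (map_mpoly (meval a) \o mmap (@mpolyC k _ \o @mpolyC k F)
     (fun i : 'I_k => ('X_i : {mpoly F[k]})%:MP + 'X_i))) => [c|i] /=.
  by rewrite translateC mmapC /= map_mpolyC /= mevalC.
rewrite translateX mmapX mmap1U rmorphD /= map_mpolyC map_mpolyX /= mevalXU.
by rewrite addrC.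
Qed.

(** * Schwartz-Zippel lemma with multiplicities *)

Lemma size_prod_XsubC_exp (F : fieldType) (T : finType) (v : T -> F)
    (N : T -> nat) :
  size (\prod_x ('X - (v x)%:P) ^+ N x) = (\sum_x N x).+1.
Proof.
rewrite size_prod => [|x _]; last by rewrite expf_neq0 ?polyXsubC_eq0.
under eq_bigr do rewrite size_exp_XsubC -addn1.
by rewrite big_split /= sum1_card -addSn addnK.
Qed.

(** The factors at distinct points are coprime, so their product divides [u]. *)
Lemma leq_sum_root_mult (F : fieldType) (T : finType) (v : T -> F)
    (N : T -> nat) (u : {poly F}) :
    injective v -> u != 0 -> (forall x, ('X - (v x)%:P) ^+ N x %| u) ->
  (\sum_x N x < size u)%N.
Proof.
move=> v_inj u0 dvd_u; rewrite -(size_prod_XsubC_exp v); apply: dvdp_leq => //.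
elim: (index_enum T) (index_enum_uniq T) => [|x r IHr] /=.
  by rewrite big_nil dvd1p.
case/andP=> xr ur; rewrite big_cons Gauss_dvdp ?dvd_u ?IHr //.
apply/coprimep_expl; rewrite coprimep_sym coprimep_XsubC.
rewrite /root horner_prod prodf_seq_neq0; apply/allP => y yr /=.
rewrite !hornerE expf_neq0 // subr_eq0 (inj_eq v_inj).
by apply: contraNneq xr => ->.
Qed.

Lemma XsubC_exp_dvdp (F : fieldType) (c : F) (N : nat) (u : {poly F}) :
  (forall j, (j < N)%N -> (u \Po ('X + c%:P))`_j = 0) -> ('X - c%:P) ^+ N %| u.
Proof.
move=> low0; rewrite -(comp_polyXaddC_K u c).
rewrite -[u \Po _](poly_take_drop N) (_ : take_poly _ _ = 0) ?add0r.
  by rewrite rmorphM rmorphXn /= comp_polyX dvdp_mull.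
by apply/polyP => j; rewrite coef_take_poly coef0; case: ifP => // /low0.
Qed.

(** * Isolating the last variable *)

Section LastVariable.
Context (n : nat) (R : comNzRingType).
Implicit Types (p : {mpoly R[n.+1]}) (m : 'X_{1..n}).

Definition mnm_rcons m (j : nat) : 'X_{1..n.+1} :=
  (mnmwiden m + U_(ord_max) *+ j)%MM.

Lemma mdeg_mnm_rcons m j : mdeg (mnm_rcons m j) = (mdeg m + j)%N.
Proof.
rewrite mdegD mdegMn mdeg1 mul1n; congr (_ + _)%N.
rewrite !mdegE big_ord_recr /= mnmwiden_ordmax addn0.
by apply: eq_bigr => i _; rewrite mnmwiden_widen.
Qed.

Lemma mnm_rconsE (M : 'X_{1..n.+1}) m j :
  (M == mnm_rcons m j) =
  ([multinom M (widen_ord (leqnSn n) i) | i < n] == m) && (M ord_max == j).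
Proof.
have mxE : mnm_rcons m j ord_max = j.
  by rewrite mnmDE mnmwiden_ordmax mulmnE mnm1E eqxx mul1n.
have wE i : mnm_rcons m j (widen_ord (leqnSn n) i) = m i.
  rewrite mnmDE mnmwiden_widen mulmnE mnm1E -val_eqE /=.
  by rewrite gtn_eqF ?mul0n ?addn0.
apply/eqP/andP => [->|[/eqP <- /eqP Mj]].
  by rewrite mxE eqxx; split=> //; apply/eqP/mnmP => i; rewrite mnmE wE.
apply/mnmP => i; have [|ltin] := leqP n i.
  move=> ni; have -> : i = ord_max.
    by apply/val_inj/eqP; rewrite eqn_leq ni -ltnS ltn_ord.
  by rewrite -Mj mnmDE mnmwiden_ordmax mulmnE mnm1E eqxx mul1n.
have -> : i = widen_ord (leqnSn n) (Ordinal ltin) by apply/val_inj.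
rewrite mnmDE mnmwiden_widen mulmnE mnm1E -val_eqE /= mnmE.
by rewrite gtn_eqF ?mul0n ?addn0.
Qed.

Lemma mcoeff_muni p j m : (muni p)`_j@_m = p@_(mnm_rcons m j).
Proof.
rewrite muniE coef_sum [in RHS](mpolyE p) !raddf_sum; apply: eq_bigr => M _ /=.
rewrite !mcoeffZ mcoeffX mnm_rconsE coefZ coefXn eq_sym.
case: (_ == j); last by rewrite andbF mulr0 mcoeff0 mulr0.
by rewrite mulr1 andbT mcoeffZ mcoeffX.
Qed.

Lemma muni_eq0 p : (muni p == 0) = (p == 0).
Proof.
apply/eqP/eqP => [p0|->]; last exact: muni0.
apply/mpolyP => M; pose m := [multinom M (widen_ord (leqnSn n) i) | i < n].
have /eqP -> : M == mnm_rcons m (M ord_max) by rewrite mnm_rconsE !eqxx.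
by rewrite -mcoeff_muni p0 coef0 !mcoeff0.
Qed.

Lemma muniX_max : muni ('X_ord_max : {mpoly R[n.+1]}) = 'X.
Proof.
apply/polyP => j; apply/mpolyP => m.
rewrite mcoeff_muni mcoeffX mnm_rconsE mnm1E eqxx coefX [j == 1%N]eq_sym.
case: (_ == j); rewrite ?andbF ?mcoeff0 // andbT mcoeff1 [m == _]eq_sym.
congr (nat_of_bool (_ == m))%:R.
by apply/mnmP => i; rewrite mnmE mnm1E mnm0E -val_eqE /= gtn_eqF.
Qed.

Lemma muniX_widen (i : 'I_n) :
  muni ('X_(widen_ord (leqnSn n) i) : {mpoly R[n.+1]}) = ('X_i)%:P.
Proof.
apply/polyP => j; apply/mpolyP => m.
have /negPf wmax : widen_ord (leqnSn n) i != ord_max.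
  by rewrite -val_eqE /= ltn_eqF.
rewrite mcoeff_muni mcoeffX mnm_rconsE mnm1E coefC wmax [j == 0%N]eq_sym.
case: (_ == j); rewrite ?andbF ?mcoeff0 // andbT mcoeffX.
congr (nat_of_bool (_ == m))%:R.
by apply/mnmP => l; rewrite mnmE !mnm1E -val_eqE.
Qed.

Lemma muni_translate (a : 'I_n.+1 -> R) p :
  muni (translate a p) =
  map_poly (translate (fun i => a (widen_ord (leqnSn n) i))) (muni p)
    \Po ('X + ((a ord_max)%:MP)%:P).
Proof.
pose psi := (comp_poly ('X + ((a ord_max)%:MP)%:P) \o
  map_poly (translate (fun i => a (widen_ord (leqnSn n) i)))) \o @muni n R.
apply: (@eq_mpoly_rmorph _ _ _ (@muni n R \o translate a) psi) => [c|i] /=.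
  by rewrite translateC muniC map_polyC /= comp_polyC translateC.
rewrite translateX rmorphD /= muniC.
have [ni|ltin] := leqP n i.
  have -> : i = ord_max.
    by apply/val_inj/eqP; rewrite eqn_leq ni -ltnS ltn_ord.
  by rewrite muniX_max map_polyX comp_polyX.
have -> : i = widen_ord (leqnSn n) (Ordinal ltin) by apply/val_inj.
by rewrite muniX_widen map_polyC /= comp_polyC translateX rmorphD.
Qed.

(** Since [g] has scalar coefficients, extracting a coefficient in the [n] variables commutes with
    substituting [g]. *)
Lemma mcoeff_comp_polyC m j (r : {poly {mpoly R[n]}}) (g : {poly R}) :
  ((r \Po map_poly (@mpolyC n R) g)`_j)@_m = (map_poly (mcoeff m) r \Po g)`_j.
Proof.
have comp_wide (A : comNzRingType) (f h : {poly A}) N : (size f <= N)%N ->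
    f \Po h = \sum_(i < N) f`_i *: h ^+ i.
  move=> sf; rewrite /comp_poly (@horner_coef_wide _ N) ?size_map_polyC //.
  by apply: eq_bigr => i _; rewrite coef_map mul_polyC.
rewrite (comp_wide _ r _ (size r)) // (comp_wide _ _ g (size r)) ?size_poly //.
rewrite !coef_sum raddf_sum; apply: eq_bigr => i _ /=.
by rewrite !coefZ coef_map -rmorphXn coef_map /= mulrC mcoeffCM mulrC.
Qed.
End LastVariable.

(** Take a monomial of least degree in the support of the translate; its degree is the exact
    multiplicity of [p] at [a]. *)
Lemma ex_mult_ge (n : nat) (R : comNzRingType) (a : 'I_n -> R)
    (p : {mpoly R[n]}) :
  p != 0 -> exists2 m, (translate a p)@_m != 0 & mult_ge (mdeg m) a p.
Proof.
rewrite -(translate_eq0 a) => q0.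
pose P d := has (fun m => mdeg m == d) (msupp (translate a p)).
have exP : exists d, P d.
  exists (mdeg (mlead (translate a p))); apply/hasP.
  by exists (mlead (translate a p)); rewrite ?mlead_supp.
case: (ex_minnP exP) => d /hasP [m mq /eqP dm] min_d.
exists m => [|m' lt]; first by rewrite -mcoeff_msupp.
apply: memN_msupp_eq0; apply: contraL lt => m'q; rewrite -leqNgt dm.
by apply: min_d; apply/hasP; exists m'.
Qed.

Lemma sum_ffun_ordS (T : finType) (n : nat) (t : {ffun 'I_n.+1 -> T} -> nat) :
  (\sum_a t a = \sum_(a : {ffun 'I_n -> T}) \sum_(x : T)
     t [ffun i => oapp a x (insub (val i))])%N.
Proof.
(* [insub] fails exactly at the last index, so [ext] appends the coordinate [ax.2] to the point
   [ax.1]. *)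
pose ext (ax : {ffun 'I_n -> T} * T) : {ffun 'I_n.+1 -> T} :=
  [ffun i => oapp ax.1 ax.2 (insub (val i))].
pose res (b : {ffun 'I_n.+1 -> T}) : {ffun 'I_n -> T} * T :=
  ([ffun i => b (widen_ord (leqnSn n) i)], b ord_max).
rewrite pair_big (reindex ext) //; exists res => [[a x] _|b _].
  congr pair; last by rewrite ffunE insubF ?ltnn.
  by apply/ffunP => i; rewrite !ffunE /= valK.
apply/ffunP => i; rewrite ffunE; case: insubP => [j _ ji|] /=.
  by rewrite ffunE; congr (b _); apply/val_inj.
rewrite -leqNgt => ni; congr (b _); apply/val_inj/eqP => /=.
by rewrite eqn_leq ni -ltnS ltn_ord.
Qed.

Lemma mult_ge_nvar0 (R : comNzRingType) (mu : nat) (a : 'I_0 -> R)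
    (p : {mpoly R[0]}) :
  p != 0 -> mult_ge mu a p -> mu = 0%N.
Proof.
move=> p0 vp; have [m qm _] := ex_mult_ge a p0.
apply/eqP; rewrite -leqn0 leqNgt; apply: contra qm => mu0.
by rewrite vp // mdegE big_ord0.
Qed.

(* The factor [#|T|] keeps the bound sharp at [k = 0], where [k.-1] would be
   truncated; the induction needs this. *)
Lemma schwartz_zippel_mult_scaled (F : fieldType) (T : finType) (v : T -> F)
    (k d : nat) (p : {mpoly F[k]}) (t : {ffun 'I_k -> T} -> nat) :
    injective v -> p != 0 -> (msize p <= d.+1)%N ->
    (forall a, mult_ge (t a) (v \o a) p) ->
  (#|T| * (\sum_a t a) <= d * #|T| ^ k)%N.
Proof.
move=> v_inj; elim: k d p t => [|k IHk] d p t p0 sp vp.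
  by rewrite big1 ?muln0 // => a _; apply: mult_ge_nvar0 (vp a).
(* [l] is the coefficient of the highest power [e] of the last variable; its degree is at most
   [d - e], and the induction hypothesis is applied to it. *)
pose q := muni p; pose l := lead_coef q; pose e := (size q).-1.
have l0 : l != 0 by rewrite lead_coef_eq0 muni_eq0.
have degl m : l@_m != 0 -> (mdeg m + e <= d)%N.
  rewrite /l lead_coefE mcoeff_muni -mcoeff_msupp => /msize_mdeg_lt lt.
  by rewrite -mdeg_mnm_rcons -ltnS; apply: leq_trans sp.
have led : (e <= d)%N.
  have := mlead_supp l0; rewrite mcoeff_msupp => /degl.
  exact/leq_trans/leq_addl.
have sl : (msize l <= (d - e).+1)%N.
  apply/msize_leP => m lt; apply/eqP; apply: contraLR lt => /degl.
  by rewrite -leqNgt leq_subRL // addnC.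
(* [mdeg (E a)] is the exact multiplicity of [l] at the point given by [a]. *)
have [E Enz El] := fin_all_exists2 (fun a : {ffun 'I_k -> T} =>
  ex_mult_ge (v \o a) l0).
have row (a : {ffun 'I_k -> T}) :
    (\sum_x t [ffun i => oapp a x (insub (val i))] <= #|T| * mdeg (E a) + e)%N.
  (* [u] is the Hasse derivative of [p] of index [E a] (in the first [k]
     variables) at (a, X): it still has degree [e], and its
     multiplicity at a point drops by at most [mdeg (E a)]. *)
  pose u := map_poly (mcoeff (E a)) (map_poly (translate (v \o a)) q).
  have ue : u`_e = (translate (v \o a) l)@_(E a) by rewrite !coef_map.
  have u0 : u != 0 by apply: contraNneq (Enz a) => u0; rewrite -ue u0 coef0.
  have su : (size u <= e.+1)%N.
    rewrite /e prednK ?size_poly_gt0 ?muni_eq0 //.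
    by apply: leq_trans (size_poly _ _) _; apply: size_poly.
  pose b x : {ffun 'I_k.+1 -> T} := [ffun i => oapp a x (insub (val i))].
  have dvd_u x : ('X - (v x)%:P) ^+ (t (b x) - mdeg (E a)) %| u.
    apply: XsubC_exp_dvdp => j ltj; rewrite -mcoeff_comp_polyC.
    rewrite rmorphD /= map_polyX map_polyC /=.
    have := @muni_translate k F (v \o b x) p.
    have -> : (v \o b x) ord_max = v x by rewrite /= ffunE insubF ?ltnn.
    have -> : map_poly (translate (fun i => (v \o b x) (widen_ord (leqnSn k) i)))
        (muni p) = map_poly (translate (v \o a)) q.
      apply: eq_map_poly => r; congr (r \mPo _).
      by apply: eq_mktuple => i; rewrite /= ffunE /= valK.
    move <-; rewrite mcoeff_muni vp // mdeg_mnm_rcons.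
    by rewrite -ltn_subRL.
  (* The prescribed roots of [u] number at most [e] with multiplicity; adding back [mdeg (E a)] at
     each of the [#|T|] points gives the bound. *)
  have := leq_trans (leq_sum_root_mult v_inj u0 dvd_u) su; rewrite ltnS => le.
  rewrite addnC -sum_nat_const (leq_trans _ (leq_add le (leqnn _))) //.
  by rewrite -big_split leq_sum // => x _ /=; rewrite addnC -leq_subLR.
(* The terms [mdeg (E a)] contribute at most [(d - e) * #|T| ^ k] by induction, and the terms [e]
   make up the rest. *)
have IH := IHk _ _ (fun a => mdeg (E a)) l0 sl El.
rewrite sum_ffun_ordS expnS mulnCA leq_mul2l; apply/orP; right.
apply: leq_trans (leq_sum _ (fun a _ => row a)) _.
rewrite big_split /= -big_distrr sum_nat_const card_ffun card_ord.
rewrite [(_ * e)%N]mulnC -[X in (_ <= X * _)%N](subnK led) mulnDl.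
by rewrite leq_add2r.
Qed.

Lemma schwartz_zippel_mult (F : fieldType) (T : finType) (v : T -> F)
    (k d : nat) (p : {mpoly F[k]}) (t : {ffun 'I_k -> T} -> nat) :
    injective v -> p != 0 -> (msize p <= d.+1)%N ->
    (forall a, mult_ge (t a) (v \o a) p) ->
  (\sum_a t a <= d * #|T| ^ k.-1)%N.
Proof.
case: k p t => [|k] p t v_inj p0 sp vp.
  by rewrite big1 // => a _; apply: mult_ge_nvar0 (vp a).
have := schwartz_zippel_mult_scaled v_inj p0 sp vp.
(* With [T] empty there is no point at all, as at least one coordinate is required; otherwise [#|T|]
   cancels. *)
have [T0 _|Tpos] := posnP #|T|; last by rewrite expnS mulnCA leq_pmul2l.
rewrite big1 // => a _.
by have := fintype0 (a ord0) T0.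
Qed.

(** * Generalized Wronskians *)

Local Notation "x %:F" := (@FracField.tofrac _ x).

Lemma fraction_numdenP (R : idomainType) (x : {fraction R}) :
  exists (n d : R), d != 0 /\ d%:F * x = n%:F.
Proof.
elim/quotW: x => r; exists (\n_r), (\d_r); split; first exact: denom_ratioP.
unlock FracField.tofrac; rewrite -[LHS]FracField.pi_mul /FracField.mulf.
apply/eqmodP; rewrite /= FracField.equivfE.
by rewrite !numden_Ratio ?mul1r ?mulr1 ?oner_neq0 ?denom_ratioP // mulrC.
Qed.

Lemma clear_denominators (R : idomainType) (s : nat) (g : 'cV[{fraction R}]_s) :
  exists (c : R) (h : 'I_s -> R), c != 0 /\ forall j, c%:F * g j 0 = (h j)%:F.
Proof.
have num_den j := fraction_numdenP (g j 0).
have [num /fin_all_exists[den dP]] := fin_all_exists num_den.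
exists (\prod_j den j), (fun j => (\prod_(i | i != j) den i) * num j).
split=> [|j]; first by apply/prodf_neq0 => j _; case: (dP j).
rewrite (bigD1 j) //= !rmorphM /= -(proj2 (dP j)).
by rewrite mulrA [_%:F * (den j)%:F]mulrC.
Qed.

Section Wronskian.
Context (F : fieldType) (k d s : nat) (f : 'I_s -> {mpoly F[k]}).
Hypothesis char_gt_d : forall n, (0 < n <= d)%N -> n%:R != 0 :> F.
Hypothesis f_deg : forall j, (msize (f j) <= d.+1)%N.
Hypothesis f_free : forall c : 'I_s -> F,
  \sum_j c j *: f j = 0 -> forall j, c j = 0.
Implicit Types (h : 'I_s -> {mpoly F[k]}) (e : 'X_{1..k}).

Let pairing h e := \sum_j h j * (f j)^`M[e].

(** This is orthogonality of [h] to the space [V_n] of derivative vectors. *)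
Definition annihilates n h := forall e, (mdeg e < n)%N -> pairing h e = 0.

Lemma mderiv_pairing i h e :
  (pairing h e)^`M(i) =
  pairing (fun j => (h j)^`M(i)) e + pairing h (e + U_(i))%MM.
Proof.
rewrite /pairing raddf_sum -big_split; apply: eq_bigr => j _ /=.
by rewrite mderivM mderivmDm mderivmU1m.
Qed.

Lemma annihilates_mderiv n i h :
  annihilates n.+1 h -> annihilates n (fun j => (h j)^`M(i)).
Proof.
move=> ann_h e lt; have := mderiv_pairing i h e.
rewrite !ann_h ?mdegD ?mdeg1 ?addn1 ?ltnS // 1?ltnW // raddf0 addr0.
by move=> <-.
Qed.

(** Induction on [e], for all [h] at once: stability raises the order of annihilation to [n.+1],
    differentiating [h] brings it back to [n], and the Leibniz rule passes from [e] to
    [e + U_(i)]. *)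
Lemma annihilates_all n h :
    (forall h, annihilates n h -> annihilates n.+1 h) ->
  annihilates n h -> forall e, pairing h e = 0.
Proof.
move=> stable ann_h e; elim/mnm_ind: e h ann_h => [|e i IHe] h ann_h.
  by apply: (stable h) => //; rewrite mdeg0.
have := mderiv_pairing i h e; rewrite (IHe h) // raddf0 IHe ?add0r => [<- //|].
exact/annihilates_mderiv/stable.
Qed.

(** This product of factorials is the coefficient produced by differentiating the monomial of
    exponent [e] by [e]; all its factors are at most [d]. *)
Lemma prod_ffact_neq0 e : (mdeg e <= d)%N ->
  (\prod_(i < k) (e i) ^_ (e i))%:R != 0 :> F.
Proof.
move=> ed; rewrite natr_prod; apply/prodf_neq0 => i _.
have : (e i <= d)%N.
  by apply: leq_trans ed; rewrite mdegE (bigD1 i) //= leq_addr.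
rewrite ffactnn; elim: (e i) => [|n IHn] nd; first by rewrite oner_neq0.
by rewrite factS natrM mulf_neq0 ?IHn ?(ltnW nd) // char_gt_d.
Qed.

(** By descending induction on the degree of [m], the pairing of index [m] isolates a nonzero
    multiple of [\sum_j (f j)@_m *: h j], which therefore vanishes. *)
Lemma pairing_inj h : (forall e, pairing h e = 0) -> forall j, h j = 0.
Proof.
move=> ann_h.
have coef0 m : \sum_j (f j)@_m *: h j = 0.
  move: {-1}(d.+1 - mdeg m)%N (leqnn (d.+1 - mdeg m)) => N.
  elim: N m => [|N IHN] m leN.
    rewrite big1 // => j _; have /msize_leP -> := f_deg j; first exact: scale0r.
    by rewrite -subn_eq0 -leqn0.
  have [ltd|led] := ltnP d (mdeg m).
    by apply: IHN; move: ltd; rewrite -subn_eq0 => /eqP ->.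
  (* In the expansion of the pairing with \partial^m, monomials of higher
     degree contribute 0 by induction and the others have coefficient 0
     unless they equal [m]. *)
  pose c (m' : 'X_{1..k}) : F := (\prod_(i < k) (m' i) ^_ (m i))%:R.
  have : pairing h m = \sum_(m' : 'X_{1..k < d.+1})
      (c m' *: 'X_[m' - m]) * \sum_j (f j)@_m' *: h j.
    rewrite /pairing; under eq_bigr do rewrite (@mderivmwE _ _ d.+1) // mulr_sumr.
    rewrite exchange_big; apply: eq_bigr => m' _; rewrite mulr_sumr.
    apply: eq_bigr => j _; rewrite -scalerA -/(c m').
    by rewrite -!scalerAr -!scalerAl [h j * _]mulrC.
  rewrite ann_h (bigD1 (BMultinom (led : (mdeg m < d.+1)%N))) //=.
  rewrite [X in _ + X]big1.
    rewrite addr0 => /esym/eqP; rewrite mulf_eq0 => /orP[|/eqP //].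
    rewrite -mul_mpolyC mulf_eq0 mpolyC_eq0 (negPf (prod_ffact_neq0 led)).
    by rewrite -msize_poly_eq0 msizeX.
  move=> m' ne; have [ltm|lem] := ltnP (mdeg m) (mdeg m').
    rewrite IHN ?mulr0 //.
    by rewrite -ltnS; apply: leq_trans leN; apply: ltn_sub2l.
  rewrite (_ : c m' = 0) ?scale0r ?mul0r //; apply/eqP.
  rewrite /c natr_prod prodf_seq_eq0; apply: contraNT ne => /hasPn nz.
  have lemm : (m <= m')%MM.
    apply/mnm_lepP => i; rewrite leqNgt; apply/negP => /ffact_small z.
    by have := nz i (mem_index_enum i); rewrite /= z eqxx.
  apply/eqP/val_inj => /=; rewrite -(submK lemm) addmC.
  have /eqP -> : (m' - m == 0)%MM.
    rewrite -mdeg_eq0; move: lem; rewrite -{1}(submK lemm) mdegD.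
    by rewrite -{2}[mdeg m]add0n leq_add2r leqn0.
  by rewrite addm0.
(* For a fixed monomial [n], the scalars [(h j)@_n] form a linear relation over [F] between the
   [f j]. *)
move=> j; apply/mpolyP => n; rewrite mcoeff0.
apply: (f_free (c := fun j => (h j)@_n)); apply/mpolyP => m.
rewrite mcoeff0 raddf_sum; have /(congr1 (mcoeff n)) := coef0 m.
rewrite mcoeff0 raddf_sum /= => E0; rewrite -[RHS]E0; apply: eq_bigr => i _.
by rewrite !mcoeffZ mulrC.
Qed.

(** The row space of [A n] is [V_n], taken over the fraction field so that rank arguments apply. *)
Let A n : 'M[{fraction {mpoly F[k]}}]_(#|{: 'X_{1..k < n}}|, s) :=
  \matrix_(i, j) ((f j)^`M[val (enum_val i)])%:F.

Lemma annihilatesP n h :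
  annihilates n h <-> A n *m \col_j (h j)%:F = 0.
Proof.
have AE i : (A n *m \col_j (h j)%:F) i 0 = (pairing h (val (enum_val i)))%:F.
  rewrite mxE rmorph_sum; apply: eq_bigr => j _ /=.
  by rewrite !mxE mulrC rmorphM.
split=> [ann_h|/matrixP A0 e lt].
  by apply/matrixP => i j; rewrite ord1 AE mxE ann_h ?rmorph0 ?bmdeg.
have /eqP := A0 (enum_rank (BMultinom lt)) 0.
by rewrite AE enum_rankK mxE tofrac_eq0 => /eqP.
Qed.

Lemma sub_A n : (A n <= A n.+1)%MS.
Proof.
apply/row_subP => i; pose m := enum_val i.
pose m' := BMultinom (ltnW (bmdeg m) : mdeg m < n.+1)%N.
have -> : row i (A n) = row (enum_rank m') (A n.+1).
  by apply/rowP => j; rewrite !mxE enum_rankK.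
exact: row_sub.
Qed.

Lemma rank_A n : (n <= s)%N -> (n <= \rank (A n))%N.
Proof.
elim: n => // n IHn lts; have {}IHn := IHn (ltnW lts).
rewrite ltnNge; apply/negP => le_n.
(* If the bound fails at [n.+1], both ranks equal [n], so the row spaces coincide and annihilation
   is stable at order [n]. *)
have [leA /esym eqA] := mxrank_leqif_sup (sub_A n).
have eqr : \rank (A n) = \rank (A n.+1).
  by apply/eqP; rewrite eqn_leq leA (leq_trans le_n).
rewrite eqr eqxx in eqA; have /submxP [B eqB] := idP eqA.
have stable h : annihilates n h -> annihilates n.+1 h.
  by move=> /annihilatesP Ah; apply/annihilatesP; rewrite eqB -mulmxA Ah mulmx0.
(* Since [n < s], the columns of [A n] satisfy a nontrivial relation; cleared of denominators it
   becomes a polynomial vector [h], which stability forces to be zero. *)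
have : kermx (A n)^T != 0.
  by rewrite kermx_eq0 /row_free mxrank_tr neq_ltn eqr (leq_ltn_trans le_n).
case/rowV0Pn => v /sub_kermxP vA v0.
have [c [h [c0 hE]]] := clear_denominators v^T.
have hv : \col_j (h j)%:F = c%:F *: v^T.
  by apply/colP => j; rewrite mxE -hE !mxE.
have : annihilates n h.
  apply/annihilatesP; rewrite hv -scalemxAr -[A n]trmxK -trmx_mul vA.
  by rewrite trmx0 scaler0.
move=> /(annihilates_all stable)/pairing_inj h0.
case/negP: v0; rewrite -trmx_eq0; apply/eqP/colP => j; rewrite [RHS]mxE.
have := hE j; rewrite h0 rmorph0 => /eqP.
by rewrite mulf_eq0 tofrac_eq0 (negPf c0) => /eqP.
Qed.

(** [A s] has full column rank, so some [s] of its rows form an invertible matrix. *)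
Lemma wronskian_neq0 : exists e : 'I_s -> 'X_{1..k},
  (forall i, mdeg (e i) < s)%N /\ \det (\matrix_(i, j) (f j)^`M[e i]) != 0.
Proof.
have fullA : row_full (A s) by rewrite /row_full eqn_leq rank_leq_col rank_A.
exists (fun i => val (enum_val (fullrankfun fullA i))); split=> [i|].
  exact: bmdeg.
rewrite -tofrac_eq0 -det_map_mx -unitfE -unitmxE -row_full_unit.
rewrite (_ : map_mx _ _ = rowsub (fullrankfun fullA) (A s)).
  exact: fullrowsub_full.
by apply/matrixP => i j; rewrite !mxE.
Qed.

End Wronskian.

(** * Dimensions *)

Section Dimension.
Context (F : fieldType) (k : nat).
Implicit Types (P : {mpoly F[k]} -> Prop) (f : {mpoly F[k]}).

Lemma has_freebP P n : reflect (has_free P n) (has_freeb P n).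
Proof.
rewrite /has_freeb; case: (excluded_middle_informative (has_free P n)) => h;
  by constructor.
Qed.

Lemma has_free_dimP P : has_free P (dimP P).
Proof.
rewrite /dimP; case: excluded_middle_informative => [Hb|_].
  by case: ex_maxnP => n /has_freebP.
exact/has_freebP/has_freeb0.
Qed.

(** The bound [N] rules out the default value of [dimP], which could be too small. *)
Lemma leq_dimP P n N :
  (forall m, has_free P m -> (m <= N)%N) -> has_free P n -> (n <= dimP P)%N.
Proof.
move=> bound /has_freebP fn; rewrite /dimP.
case: excluded_middle_informative => [Hb|[]]; last first.
  by exists N => m /has_freebP; apply: bound.
by case: ex_maxnP => m _; apply.
Qed.

(** The matrix of coefficients has independent rows, and its columns are indexed by the monomials of
    degree at most [d]. *)
Lemma has_free_bounded P d n :
    (forall f, P f -> deg_le d f) -> has_free P n ->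
  (n <= #|{: 'X_{1..k < d.+1}}|)%N.
Proof.
move=> degP [b [Pb free_b]].
pose C := \matrix_(i < n, j < #|{: 'X_{1..k < d.+1}}|)
  (tnth b i)@_(val (enum_val j)).
suff /eqP <- : row_free C by apply: rank_leq_col.
apply: inj_row_free => v vC; apply/rowP => i; rewrite mxE.
apply: (free_b (v 0)); apply/mpolyP => m; rewrite mcoeff0 raddf_sum /=.
have [lt|ge] := ltnP (mdeg m) d.+1; last first.
  rewrite big1 // => j _; have /msize_leP bj := degP _ (Pb j).
  by rewrite mcoeffZ bj ?mulr0.
have /matrixP/(_ 0 (enum_rank (BMultinom lt))) := vC; rewrite !mxE => E0.
by rewrite -[RHS]E0; apply: eq_bigr => j _; rewrite mcoeffZ mxE enum_rankK.
Qed.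

(** Otherwise [f :: b] would be a free family of size [n.+1]. *)
Lemma maximal_free_span P n (b : n.-tuple {mpoly F[k]}) f :
    (forall m, has_free P m -> (m <= n)%N) ->
    (forall i, P (tnth b i)) -> lin_indep b -> P f ->
  exists c : 'I_n -> F, f = \sum_i c i *: tnth b i.
Proof.
move=> maxn Pb free_b Pf.
have [//|nspan] := excluded_middle_informative
  (exists c : 'I_n -> F, f = \sum_i c i *: tnth b i).
suff /maxn : has_free P n.+1 by rewrite ltnn.
exists [tuple of f :: b]; split=> [i|c].
  by case: (unliftP ord0 i) => [j|] ->; rewrite ?tnthS ?tnth0.
rewrite big_ord_recl tnth0; under eq_bigr do rewrite tnthS.
have [c0|c0] := eqVneq (c ord0) 0.
  rewrite c0 scale0r add0r => /free_b cl i.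
  by case: (unliftP ord0 i) => [j|] ->.
move=> /eqP; rewrite addr_eq0 => /eqP /(congr1 ( *:%R (c ord0)^-1)).
rewrite scalerA mulVf // scale1r => fE; case: nspan.
exists (fun i => - ((c ord0)^-1 * c (lift ord0 i))); rewrite fE.
by rewrite scalerN scaler_sumr -sumrN; apply: eq_bigr => i _; rewrite scalerA scaleNr.
Qed.
End Dimension.

(** * Multiplicity of the Wronskian at a point *)

Lemma mult_ge_wronskian (F : fieldType) (k s t mu : nat) (a : 'I_k -> F)
    (b : 'I_s -> {mpoly F[k]}) (g : t.-tuple {mpoly F[k]})
    (C : 'M[F]_(t, s)) (e : 'I_s -> 'X_{1..k}) :
    (s <= mu)%N -> (forall i, mdeg (e i) < s)%N -> lin_indep g ->
    (forall i, mult_ge mu a (tnth g i)) ->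
    (forall i, tnth g i = \sum_j C i j *: b j) ->
  mult_ge (t * (mu - s).+1) a (\det (\matrix_(i, j) (b j)^`M[e i])).
Proof.
move=> le_s_mu e_lt free_g vg gE.
have free_C : row_free C.
  apply: inj_row_free => v vC; apply/rowP => i; rewrite mxE.
  apply: (free_g (v 0)); under eq_bigr do rewrite gE scaler_sumr.
  rewrite exchange_big big1 // => j _; under eq_bigr do rewrite scalerA.
  have /matrixP/(_ 0 j) := vC; rewrite !mxE -scaler_suml => ->.
  by rewrite scale0r.
have le_ts : (t <= s)%N by rewrite -(eqP free_C) rank_leq_col.
(* [b'] is a basis of the span of [b] starting with a basis of that of [g]. *)
pose E := row_ebase C; pose b' i := \sum_j E i j *: b j.
have vb' (i : 'I_s) : (i < t)%N -> mult_ge mu a (b' i).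
  move=> lt_it; have : (row i E <= C)%MS.
    have lt_ir : (i < \rank C)%N by rewrite (eqP free_C).
    rewrite -(eq_row_base C) (_ : row i E = row (Ordinal lt_ir) (row_base C)).
      exact: row_sub.
    rewrite row_mul [LHS]rowE; congr (_ *m _); apply/rowP => j.
    by rewrite !mxE /= lt_ir andbT eq_sym -val_eqE.
  case/submxP => D ED.
  have -> : b' i = \sum_l D 0 l *: tnth g l.
    under [RHS]eq_bigr do rewrite gE scaler_sumr.
    rewrite exchange_big; apply: eq_bigr => j _.
    have /rowP/(_ j) := ED; rewrite !mxE => ->; rewrite scaler_suml.
    by apply: eq_bigr => l _; rewrite scalerA.
  by apply: mult_ge_sum => l _; apply/mult_geZ/vg.
pose M := \matrix_(i, j) (b j)^`M[e i].
pose M' := \matrix_(i, j) (b' j)^`M[e i].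
have M'E : M' = M *m (map_mx (@mpolyC k F) E)^T.
  apply/matrixP => i j; rewrite !mxE raddf_sum; apply: eq_bigr => l _ /=.
  by rewrite !mxE mderivmZ -mul_mpolyC mulrC.
have detE : \det E != 0 by rewrite -unitfE -unitmxE row_ebase_unit.
(* The change of basis multiplies the determinant by the nonzero scalar [\det E]. *)
have -> : \det M = (\det E)^-1 *: \det M'.
  rewrite M'E det_mulmx det_tr det_map_mx mulrC mul_mpolyC.
  by rewrite scalerA mulVf // scale1r.
apply/mult_geZ/mult_ge_sum => sg _; rewrite -[(t * _)%N]add0n.
apply: mult_geM => //.
(* Each term of the determinant takes one entry per column; only the first [t] columns are
   counted. *)
pose nu (j : 'I_s) := if (j < t)%N then (mu - s).+1 else 0%N.
have -> : (t * (mu - s).+1 = \sum_i nu (sg i))%N.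
  transitivity (\sum_i nu i)%N; last exact: (reindex_perm sg).
  rewrite /nu -big_mkcond /=.
  by rewrite -(big_ord_widen s (fun=> (mu - s).+1)) // sum_nat_const card_ord.
apply: mult_ge_prod => i _; rewrite mxE /nu; case: ltnP => // lt.
(* As [mdeg (e i) < s] strictly, multiplicity [(mu - s).+1] survives the derivative. *)
apply: mult_ge_leq (mult_ge_mderivm (vb' _ lt)).
by apply: ltn_sub2l => //; apply: leq_trans le_s_mu.
Qed.

(** If [n] vanished in [F], a prime characteristic would divide it and so be at most [d]. *)
Lemma natr_neq0_pchar (F : fieldType) (d n : nat) :
    [pchar F] =i pred0 \/ (forall p, p \in [pchar F] -> (d < p)%N) ->
  (0 < n <= d)%N -> n%:R != 0 :> F.
Proof.
move=> hchar /andP[n0 nd]; apply/negP => /[dup] nF /(natf0_pchar n0)[p pF].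
case: hchar => [h|/(_ p pF) dp]; first by rewrite h in pF.
move: nF; rewrite -(dvdn_pcharf pF) => /(dvdn_leq n0) pn.
by have := leq_trans dp (leq_trans pn nd); rewrite ltnn.
Qed.

(** * The dimension bound *)

Local Open Scope fset_scope.

Theorem theorem5p1 (F : fieldType) (k d mu w : nat)
    (hchar : [pchar F] =i pred0 \/ (forall p : nat, p \in [pchar F] -> (d < p)%N))
    (hw : (0 < w)%N) (hmu : (w <= mu)%N)
    (W : {mpoly F[k]} -> Prop) (hW : is_subspace W)
    (hWdeg : forall f, W f -> deg_le d f) (hdim : (dimP W <= w)%N)
    (S : {fset F}) :
  ((\sum_(a : {ffun 'I_k -> S})
       dimP (fun f : {mpoly F[k]} =>
               H_space d mu (fun i : 'I_k => val (a i)) f /\ W f))%:R : rat)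
  <= (d * w * #|` S| ^ k.-1)%:R / (mu - w + 1)%:R.
Proof.
pose t (a : {ffun 'I_k -> S}) := dimP (fun f : {mpoly F[k]} =>
  H_space d mu (fun i => val (a i)) f /\ W f).
pose s := dimP W; have le_s_mu : (s <= mu)%N := leq_trans hdim hmu.
(* Bounded degree makes [W] finite dimensional, so [s] is its true dimension and not the default
   value. *)
have max_s m : has_free W m -> (m <= s)%N.
  by apply: leq_dimP => n; apply: has_free_bounded hWdeg.
have [b [Wb free_b]] := has_free_dimP W.
have [e [e_lt wr0]] := wronskian_neq0 (fun n => natr_neq0_pchar hchar)
  (fun j => hWdeg _ (Wb j)) free_b.
set wr := \det _ in wr0.
have swr : (msize wr <= (s * d).+1)%N.
  by apply: msize_det_le => i j; rewrite mxE; apply/msize_mderivm/hWdeg/Wb.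
have vwr a : mult_ge (t a * (mu - s).+1) (val \o a) wr.
  have [g [Pg free_g]] := has_free_dimP (fun f =>
    H_space d mu (fun i : 'I_k => val (a i)) f /\ W f).
  have span_g i := maximal_free_span max_s Wb free_b (proj2 (Pg i)).
  have [c gE] := fin_all_exists span_g.
  apply: (mult_ge_wronskian (C := \matrix_(i, j) c i j)) e_lt free_g _ _ => //.
    by move=> i; case: (Pg i) => -[_ /mult_ge_vanish].
  by move=> i; rewrite gE; apply: eq_bigr => j _; rewrite mxE.
have := schwartz_zippel_mult (@val_inj _ _ S) wr0 swr vwr.
rewrite -big_distrl /= -cardfE => sz.
rewrite ler_pdivlMr ?ltr0n ?addn1 // -natrM ler_nat.
(* Passing from [s] to the larger [w] decreases [mu - s + 1] and increases [s * d], both of which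
   weaken the bound. *)
apply: leq_trans (leq_mul (leqnn _) (_ : _ <= (mu - s).+1)%N) _.
  by rewrite ltnS leq_sub2l.
apply: leq_trans sz _; rewrite leq_mul2r mulnC leq_mul2l.
by rewrite hdim !orbT.
Qed.
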